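(* Let $n\ge 1$, $C>0$, $\mu>0$, and let $f_1,\dots,f_n:[0,\infty)\to\mathbb{R}$ be increasing and $\mu$-strongly convex (i.e. $f_k''(x)\ge\mu$ for all $x\ge 0$). Let $(P)$, $(D)$, $f$, $\varphi$, $x_k(\cdot)$, $p_{max}$ and $L_\psi=n/\mu$ be as in the context. Let $x^*$ be the $x$-component of an optimal solution of $(P)$ and let $w^*$ be an optimal solution of $(D)$. Let the accelerated composite gradient method described in the context be run for $N\ge 1$ steps from starting points $p^0=y^0=w^0\in\mathbb{R}^n$ satisfying $0\le p_k^0\le p_{max}$ for $k=1,\dots,n$. Put $$\hat x^{N}=\frac1{A_N}\sum_{t=0}^{N}\alpha_t\,x(p^{t}).$$ Then $$f(\hat x^N)-f(x^* )\le f(\hat x^N)+\varphi(w^* )\le \varphi(w^N)+f(\hat x^N)\le \frac{148\,n^2p_{max}^2}{(N+1)^2\mu},$$ $$\Big[C-\sum_{k=1}^n \hat x_k^N\Big]_+\le \frac{148\,n^2p_{max}}{5(N+1)^2\mu}.$$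
   Context: Notation: $[a]_+=(a)_+=\max(a,0)$. Primal problem $(P)$: minimize $f(x)=\sum_{k=1}^n f_k(x_k)$ over $x,y\in\mathbb{R}^n$ subject to $\sum_{k=1}^n y_k\ge C$, $x_k\ge y_k$, $y_k\ge0$, $x_k\ge0$ for $k=1,\dots,n$. For $p_k\ge 0$ let $x_k(p_k)=\arg\max_{x_k\ge0}\{p_kx_k-f_k(x_k)\}$, and for $p\ge 0$ (componentwise) let $x(p)=(x_1(p_1),\dots,x_n(p_n))$. Dual problem $(D)$ (up to sign): minimize over $p\in\mathbb{R}^n$, $p\ge0$, the function $$\varphi(p)=\sum_{k=1}^n\{p_kx_k(p_k)-f_k(x_k(p_k))\}-C\min_{k=1,\dots,n}p_k.$$ Constants: $L_\psi=n/\mu$ and $p_{max}=\frac nC\left(\sum_{k=1}^n f_k\left(\frac{2C}{n}\right)-\sum_{k=1}^n f_k(0)\right)$. Accelerated composite gradient method: start with $\alpha_0=A_0=0$. For $t=0,1,\dots,N-1$: 1. let $\alpha_{t+1}$ be the largest root of $A_t+\alpha_{t+1}=L_\psi\alpha_{t+1}^2$ and set $A_{t+1}=A_t+\alpha_{t+1}$; 2. set $p^{t+1}=\frac{\alpha_{t+1}y^t+A_tw^t}{A_{t+1}}$ and compute $x(p^{t+1})$; 3. set $\tilde y_k^{t+1}=y_k^t-\alpha_{t+1}x_k(p_k^{t+1})$ for $k=1,\dots,n$; 4. if $\sum_{k=1}^n(-\tilde y_k^{t+1})_+\ge C\alpha_{t+1}$ put $y_{center}^{t+1}=0$, otherwise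 let $y_{center}^{t+1}>0$ be the solution of $\sum_{k=1}^n(y_{center}^{t+1}-\tilde y_k^{t+1})_+=C\alpha_{t+1}$; 5. set $y_k^{t+1}=\max(y_{center}^{t+1},\tilde y_k^{t+1})$ for $k=1,\dots,n$ and $w^{t+1}=\frac{\alpha_{t+1}y^{t+1}+A_tw^t}{A_{t+1}}$. *)

(* Defs.v *)
From HB Require Import structures.
From mathcomp Require Import all_boot all_order all_algebra.
From mathcomp Require Import all_classical all_reals all_analysis.
Set Implicit Arguments.
Unset Strict Implicit.
Unset Printing Implicit Defensive.
Import Order.TTheory GRing.Theory Num.Theory numFieldNormedType.Exports.
Local Open Scope classical_set_scope.
Local Open Scope ring_scope.

(* Functions on [0, +oo[ are represented by total functions R -> R; their     *)
(* values at negative arguments are never used.                               *)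

Definition pos_part (R : realType) (a : R) : R := Num.max a 0.

Definition increasing_on_nneg (R : realType) (f : R -> R) : Prop :=
  forall x y, 0 <= x -> x <= y -> f x <= f y.

(* Derivative relative to [0, +oo[: one-sided at 0, two-sided at x > 0.       *)
Definition derivative_on_nneg (R : realType) (f df : R -> R) : Prop :=
  forall x, 0 <= x ->
    (f y - f x) / (y - x) @[y --> within [set z | 0 <= z] x^'] --> df x.

Definition strongly_convex_on_nneg (R : realType) (mu : R) (f : R -> R)
    : Prop :=
  exists df ddf : R -> R,
    [/\ derivative_on_nneg f df, derivative_on_nneg df ddf
      & forall x, 0 <= x -> mu <= ddf x].

Section Problem.
Variables (R : realType) (n : nat) (C mu : R) (f : 'I_n -> R -> R).
Implicit Types x y p w : 'rV[R]_n.

Definition objective x : R := \sum_(k < n) f k (x 0 k).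

Definition primal_feasible x y : Prop :=
  C <= \sum_(k < n) y 0 k /\
  forall k, [/\ y 0 k <= x 0 k, 0 <= y 0 k & 0 <= x 0 k].

Definition primal_optimal x y : Prop :=
  primal_feasible x y /\
  forall x' y', primal_feasible x' y' -> objective x <= objective x'.

(* The maximizer exists and is unique for q >= 0 when f k is increasing and   *)
(* strongly convex; otherwise the value is an arbitrary maximizer, or 0 if    *)
(* there is none.                                                             *)
Definition response (k : 'I_n) (q : R) : R :=
  xget 0 [set z | 0 <= z /\
                  forall z', 0 <= z' -> q * z' - f k z' <= q * z - f k z].

Definition responses p : 'rV[R]_n := \row_k response k (p 0 k).

(* The index 0 only initializes the iterated minimum, which has no neutral    *)
(* element in R.                                                              *)
Definition min_coord (n_gt0 : (0 < n)%N) p : R :=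
  \big[Num.min/p 0 (Ordinal n_gt0)]_(k < n) p 0 k.

Definition dual_objective (n_gt0 : (0 < n)%N) p : R :=
  \sum_(k < n) (p 0 k * response k (p 0 k) - f k (response k (p 0 k)))
  - C * min_coord n_gt0 p.

Definition dual_optimal (n_gt0 : (0 < n)%N) w : Prop :=
  (forall k, 0 <= w 0 k) /\
  forall p, (forall k, 0 <= p 0 k) ->
    dual_objective n_gt0 w <= dual_objective n_gt0 p.

Definition L_psi : R := n%:R / mu.

Definition p_max : R :=
  n%:R / C * (\sum_(k < n) f k (2 * C / n%:R) - \sum_(k < n) f k 0).

Record acgm_state := ACGMState {
  acgm_alpha : R;
  acgm_A : R;
  acgm_p : 'rV[R]_n;
  acgm_y : 'rV[R]_n;
  acgm_w : 'rV[R]_n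
}.

Definition next_alpha (A : R) : R :=
  xget 0 [set a | A + a = L_psi * a ^+ 2 /\
                  forall b, A + b = L_psi * b ^+ 2 -> b <= a].

(* The argument yt is the vector y-tilde. In the else branch the solution     *)
(* exists and is unique as soon as n > 0 and 0 < C * a.                       *)
Definition y_center (a : R) (yt : 'rV[R]_n) : R :=
  if C * a <= \sum_(k < n) pos_part (- yt 0 k) then 0
  else xget 0 [set c | 0 < c /\ \sum_(k < n) pos_part (c - yt 0 k) = C * a].

Definition acgm_step (s : acgm_state) : acgm_state :=
  let a := next_alpha (acgm_A s) in
  let A := acgm_A s + a in
  let p := A^-1 *: (a *: acgm_y s + acgm_A s *: acgm_w s) in
  let yt := acgm_y s - a *: responses p in
  let y := \row_k Num.max (y_center a yt) (yt 0 k) in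
  let w := A^-1 *: (a *: y + acgm_A s *: acgm_w s) in
  ACGMState a A p y w.

Definition acgm (p0 : 'rV[R]_n) (t : nat) : acgm_state :=
  iter t acgm_step (ACGMState 0 0 p0 p0 p0).

Definition x_hat (p0 : 'rV[R]_n) (N : nat) : 'rV[R]_n :=
  (acgm_A (acgm p0 N))^-1 *:
    \sum_(0 <= t < N.+1)
       acgm_alpha (acgm p0 t) *: responses (acgm_p (acgm p0 t)).

End Problem.

(* Main.v *)
(* Estimate-sequence argument. The conjugates [q |-> max_x (q x - f_k x)] of
   the mu-strongly convex [f_k] are 1/mu-smooth with derivative [x_k(q)], and
   the linearization at [p] of the smooth part of [phi] is
   [u |-> <x(p), u> - f(x(p))]. Hence, for every [u >= 0], each step increases
   [A phi(w) + |u - y|^2 / 2] by at most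
   [alpha (<x(p), u> - f(x(p)) - C min u)]; summing these bounds and applying
   Jensen to [f] gives, for [u = (c, ..., c)] with [c >= 0],
     phi(w^N) + f(xhat) + c (C - sum xhat) <= |u - p^0|^2 / (2 A_N),
   where [A_N >= (N + 1)^2 mu / (4 n)]. The gap bound is the case [c = 0]. For
   the infeasibility take [c = 2 p_max] and combine it with the weak duality
   [phi(w* ) + f(xhat) >= (min w* ) (sum xhat - C)] and [min w* <= p_max]. *)
Require Import Defs.
From HB Require Import structures.
From mathcomp Require Import all_boot all_order all_algebra.
From mathcomp Require Import all_classical all_reals all_analysis.
From mathcomp Require Import ring lra.
Set Implicit Arguments.
Unset Strict Implicit.
Unset Printing Implicit Defensive.
Import Order.TTheory GRing.Theory Num.Theory numFieldNormedType.Exports.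
Local Open Scope ring_scope.

(** * Calculus on the half-line: from the second-derivative bound to the strong convexity
    inequality *)

Section ScalarConvexity.
Local Open Scope classical_set_scope.
Local Open Scope ring_scope.
Variable R : realType.
Implicit Types (f df ddf : R -> R) (x y z q mu : R).

(** Clearing the denominator gives a first-order expansion that also covers [y = x] and is one-sided
    at [x = 0]; differentiability and continuity both follow from it. *)
Lemma derivative_on_nneg_approx f df x (e : R) :
  derivative_on_nneg f df -> 0 <= x -> 0 < e ->
  exists2 d : R, 0 < d & forall y, 0 <= y -> `|y - x| < d ->
    `|f y - f x - df x * (y - x)| <= e * `|y - x|.
Proof.
move=> fdf x0 e0; have /cvgrPdist_le/(_ _ e0) := fdf _ x0.
rewrite !near_withinE => /nbhs_ballP[d /= d0 xd].
exists d => // y y0 yxd; have [->|yx] := eqVneq y x.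
  by rewrite !subrr mulr0 subr0 normr0 mulr0.
have yx0 : y - x != 0 by rewrite subr_eq0.
have /xd/(_ yx y0) : ball x d y by rewrite /ball/= distrC.
rewrite distrC => he.
have -> : f y - f x - df x * (y - x) =
    ((f y - f x) / (y - x) - df x) * (y - x) by field.
by rewrite normrM ler_wpM2r.
Qed.

Lemma derivative_on_nneg_is_derive f df x :
  derivative_on_nneg f df -> 0 < x -> is_derive x 1 f (df x).
Proof.
move=> fdf x0.
have H : (fun h : R => h^-1 *: (f (h *: 1 + x) - f x)) @ 0^' --> df x.
  apply/cvgrPdist_le => e e0.
  have [d d0 xd] := derivative_on_nneg_approx fdf (ltW x0) e0.
  (* The cap by [x] keeps [h + x] in the half-line, where the expansion applies. *)
  rewrite near_withinE; apply/nbhs_ballP; exists (Num.min d x) => /=.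
    by rewrite lt_min d0.
  move=> h; rewrite /ball/= sub0r normrN lt_min => /andP[hd hx] h0.
  have := xd (h *: 1 + x); rewrite [h *: 1]mulr1 addrK.
  have hx' : - h <= `|h| by rewrite -normrN ler_norm.
  have hx0 : 0 <= h + x by lra.
  move=> /(_ hx0 hd) {}xd.
  have -> : df x - h^-1 *: (f (h + x) - f x) =
    - ((f (h + x) - f x - df x * h) * h^-1) by rewrite /GRing.scale/=; field.
  by rewrite normrN normrM normfV ler_pdivrMr ?normr_gt0.
split; first by apply/cvg_ex; exists (df x).
exact: cvg_lim H.
Qed.

Lemma derivative_on_nneg_continuous f df a b :
  derivative_on_nneg f df -> 0 <= a ->
  {within `[a, b]%classic, continuous f}.
Proof.
move=> fdf a0; apply/subspace_continuousP => x /=.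
rewrite in_itv/= => /andP[ax xb].
apply/cvgrPdist_le => e e0; have x0 := le_trans a0 ax.
have [d d0 xd] := derivative_on_nneg_approx fdf x0 ltr01.
rewrite near_withinE; apply/nbhs_ballP.
have D0 : 0 < 1 + `|df x| by rewrite ltr_pwDl.
exists (Num.min d (e / (1 + `|df x|))) => /=.
  by rewrite lt_min d0 divr_gt0.
move=> y; rewrite /ball/= lt_min distrC ltr_pdivlMr// => /andP[yd ye].
rewrite in_itv/= => /andP[ay _].
have {}xd := xd y (le_trans a0 ay) yd.
rewrite distrC.
have -> : f y - f x = (f y - f x - df x * (y - x)) + df x * (y - x) by ring.
apply: le_trans (ler_normD _ _) _; rewrite normrM.
by move: xd ye; lra.
Qed.

(** Derivative-free form of strong convexity, through which the curvature bound enters all later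
    arguments. *)
Definition strong_convexity_ineq mu f := forall x y a b,
  0 <= x -> 0 <= y -> 0 <= a -> 0 <= b -> a + b = 1 ->
  f (a * x + b * y) <= a * f x + b * f y - mu / 2 * a * b * (x - y) ^+ 2.

Lemma derivative_growth df ddf mu x y :
  derivative_on_nneg df ddf -> (forall z, 0 <= z -> mu <= ddf z) ->
  0 <= x -> x <= y -> mu * (y - x) <= df y - df x.
Proof.
move=> dfd ddfmu x0 xy.
have dE z : z \in `]x, y[%R -> is_derive z 1 df (ddf z).
  rewrite in_itv/= => /andP[xz _].
  exact: derivative_on_nneg_is_derive (le_lt_trans x0 xz).
have [c + ->] := MVT_segment xy dE (derivative_on_nneg_continuous dfd x0).
rewrite in_itv/= => /andP[xc _].
by rewrite ler_wpM2r ?subr_ge0// ddfmu// (le_trans x0).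
Qed.

(** Subtracting [mu / 2 * u ^+ 2] leaves a function [g] with nondecreasing derivative. Comparing its
    mean slopes on both sides of [z = a x + b y] shows that [g] is convex, and the quadratic part
    restores the gap term. *)
Lemma strongly_convex_ineq mu f :
  strongly_convex_on_nneg mu f -> strong_convexity_ineq mu f.
Proof.
move=> [df [ddf [fdf dfd ddfmu]]] x y a b.
wlog xy : x y a b / x <= y.
  move=> H; have [xy|/ltW yx] := leP x y; first exact: H.
  move=> x0 y0 a0 b0 ab; have := H y x b a yx y0 x0 b0 a0.
  rewrite [b + a]addrC ab => /(_ erefl).
  by rewrite [b * y + _]addrC; lra.
move=> x0 y0 a0 b0 ab; set z := a * x + b * y.
have aE : a = 1 - b by lra.
have bE : b = 1 - a by lra.
have xz : x <= z by rewrite /z; nra.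
have zy : z <= y by rewrite /z; nra.
pose g u := f u - mu / 2 * u ^+ 2.
have MVTg u v : 0 <= u -> u <= v ->
    exists2 c, c \in `[u, v]%R & g v - g u = (df c - mu * c) * (v - u).
  move=> u0 uv.
  have quad : forall t : R, is_derive t 1 (fun u => mu / 2 * u ^+ 2) (mu * t).
    by move=> t; apply: is_derive_eq; rewrite /GRing.scale/=; field.
  have gD : forall t, t \in `]u, v[%R -> is_derive t 1 g (df t - mu * t).
    move=> t; rewrite in_itv/= => /andP[ut _]; apply: is_deriveB.
    exact: derivative_on_nneg_is_derive (le_lt_trans u0 ut).
  have gC : {within `[u, v], continuous g}.
    have /subspace_continuousP fC :=
      derivative_on_nneg_continuous (b := v) fdf u0.
    apply/subspace_continuousP => w wuv; apply: cvgB; first exact: fC.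
    have qC : {for w, continuous (fun u : R => mu / 2 * u ^+ 2)}.
      apply: differentiable_continuous; apply/derivable1_diffP.
      exact: ex_derive.
    exact: cvg_within_filter qC.
  by have [c cuv gE] := MVT_segment uv gD gC; exists c.
have [c1 /andP[xc1 c1z] gzx] := MVTg _ _ x0 xz.
have [c2 /andP[zc2 c2y] gyz] := MVTg _ _ (le_trans x0 xz) zy.
rewrite !bnd_simp in xc1 c1z zc2 c2y.
have := derivative_growth dfd ddfmu (le_trans x0 xc1) (le_trans c1z zc2).
have zxE : z - x = b * (y - x) by rewrite /z; rewrite aE; ring.
have yzE : y - z = a * (y - x) by rewrite /z; rewrite bE; ring.
move: gzx gyz; rewrite zxE yzE /g => gzx gyz dg.
(* Both sides carry the factor [a b (y - x)]; what remains is the derivative of [g] at [c1] and at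
   [c2], with [c1 <= z <= c2]. *)
have key : a * (g z - g x) <= b * (g y - g z).
  rewrite /g gzx gyz.
  have : 0 <= a * b * (y - x) by rewrite !mulr_ge0// subr_ge0.
  nra.
have -> : a * f x + b * f y - mu / 2 * a * b * (x - y) ^+ 2 =
  a * g x + b * g y + mu / 2 * z ^+ 2.
  by rewrite /g /z; rewrite bE; field.
have -> : f z = (a + b) * g z + mu / 2 * z ^+ 2 by rewrite ab /g; ring.
by move: key; lra.
Qed.

End ScalarConvexity.

(** * Best responses, and smoothness of the conjugates *)

Section Response.
Local Open Scope classical_set_scope.
Local Open Scope ring_scope.
Variables (R : realType) (n : nat) (mu : R) (f : 'I_n -> R -> R).
Hypothesis mu_gt0 : 0 < mu.
Hypothesis f_incr : forall k, increasing_on_nneg (f k).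
Hypothesis f_sconvex : forall k, strongly_convex_on_nneg mu (f k).
Implicit Types (k : 'I_n) (q x z : R).

(* Monotonicity at the midpoint makes the strong convexity gap pay for the
   increase of [f k] from [0] to [x]. *)
Lemma quadratic_growth k x : 0 <= x -> f k 0 + mu / 4 * x ^+ 2 <= f k x.
Proof.
move=> x0.
have h0 : 0 <= 2^-1 :> R by lra.
have h1 : 2^-1 + 2^-1 = 1 :> R by lra.
have := strongly_convex_ineq (f_sconvex k) (lexx 0) x0 h0 h0 h1.
have hx : 0 <= 2^-1 * 0 + 2^-1 * x by lra.
by have := f_incr k (lexx 0) hx; lra.
Qed.

Lemma response_spec k q : 0 <= q ->
  0 <= response f k q /\
  forall z, 0 <= z ->
    q * z - f k z <= q * response f k q - f k (response f k q).
Proof.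
move=> q0.
pose A z := 0 <= z /\ forall z', 0 <= z' -> q * z' - f k z' <= q * z - f k z.
suff AP : exists z, A z by exact: (xgetPex 0 AP).
(* Beyond [4 q / mu] the growth [mu / 4 * z ^+ 2] outweighs [q z], so [z] does no better than [0],
   and a maximizer over the compact [[0, B]] is global. *)
pose B := 4 * q / mu.
have B0 : 0 <= B by rewrite divr_ge0 ?mulr_ge0// ltW.
have [df [_ [fdf _ _]]] := f_sconvex k.
have gC : {within `[0, B]%classic, continuous (fun z => q * z - f k z)}.
  have /subspace_continuousP fC :=
    derivative_on_nneg_continuous (b := B) fdf (lexx 0).
  apply/subspace_continuousP => w wB; apply: cvgB; last exact: fC.
  have qC : {for w, continuous (fun u : R => q * u)}.
    apply: differentiable_continuous; apply/derivable1_diffP.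
    exact: ex_derive.
  exact: cvg_within_filter qC.
have [c] := EVT_max B0 gC; rewrite in_itv/= => /andP[c0 _] cmax.
exists c; split=> // z z0; have [zB|Bz] := leP z B.
  by apply: cmax; rewrite in_itv/= z0.
have := cmax 0; rewrite in_itv/= lexx B0 mulr0 sub0r => /(_ isT).
have := quadratic_growth k z0.
move: Bz; rewrite /B ltr_pdivrMr// => Bz.
have : 0 <= z * (mu * z - 4 * q) by rewrite mulr_ge0//; lra.
by nra.
Qed.

(** For [q >= 0], the Fenchel conjugate of [f k] extended by infinity to negative arguments. *)
Definition conjugate k q := q * response f k q - f k (response f k q).

Lemma conjugate_ge k q z : 0 <= q -> 0 <= z -> q * z - f k z <= conjugate k q.
Proof. by move=> q0 z0; have [_] := response_spec k q0; apply. Qed.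

Lemma response_ge0 k q : 0 <= q -> 0 <= response f k q.
Proof. by move=> q0; have [] := response_spec k q0. Qed.

(** Maximality of [r] is tested at [(1 - b) r + b z]. After division by [b], strong convexity leaves
    the gap [(1 - b) K], which tends to [K] as [b] tends to 0. *)
Lemma conjugate_quadratic_gap k q z : 0 <= q -> 0 <= z ->
  q * z - f k z <= conjugate k q - mu / 2 * (z - response f k q) ^+ 2.
Proof.
move=> q0 z0; set r := response f k q.
have r0 : 0 <= r := response_ge0 k q0.
set K := mu / 2 * (z - r) ^+ 2.
have K0 : 0 <= K by rewrite mulr_ge0 ?sqr_ge0// divr_ge0// ltW.
suff : K <= conjugate k q - (q * z - f k z) by lra.
apply/ler_addgt0Pr => e e0.
have Ke0 : 0 < K + e by lra.
(* This weight replaces the limit: it makes [b * K <= e], and the denominator is positive even when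
   [K = 0]. *)
pose b := e / (K + e).
have b0 : 0 < b by rewrite divr_gt0.
have b1 : b <= 1 by rewrite ler_pdivrMr// mul1r lerDr.
have bK : b * K <= e by rewrite /b mulrAC ler_pdivrMr// ler_pM2l// lerDl ltW.
have a0 : 0 <= 1 - b by lra.
have ab : 1 - b + b = 1 by lra.
have := strongly_convex_ineq (f_sconvex k) r0 z0 a0 (ltW b0) ab.
have w0 : 0 <= (1 - b) * r + b * z by rewrite addr_ge0// mulr_ge0// ltW.
have := conjugate_ge k q0 w0; rewrite /conjugate -/r => h1 h2.
have : 0 <= b * (q * r - f k r - (q * z - f k z) + b * K - K).
  move: h1 h2; rewrite /K; have -> : r - z = - (z - r) by ring.
  rewrite sqrrN; lra.
rewrite pmulr_rge0//; lra.
Qed.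

(** The quadratic gap at [q] is tested at the response to [q']; completing a square in [q' - q] and
    [z - r] then bounds the cross term [(q' - q) (z - r)]. *)
Lemma conjugate_smooth k q q' : 0 <= q -> 0 <= q' ->
  conjugate k q' <=
    conjugate k q + response f k q * (q' - q) + (q' - q) ^+ 2 / (2 * mu).
Proof.
move=> q0 q'0; have z0 := response_ge0 k q'0.
have := conjugate_quadratic_gap k q0 z0.
rewrite {2}/conjugate; set z := response f k q'; set r := response f k q.
have : 0 <= (q' - q - mu * (z - r)) ^+ 2 / (2 * mu).
  by rewrite divr_ge0 ?sqr_ge0// mulr_ge0// ltW.
have -> : (q' - q - mu * (z - r)) ^+ 2 / (2 * mu) = (q' - q) ^+ 2 / (2 * mu)
    - (q' - q) * (z - r) + mu / 2 * (z - r) ^+ 2.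
  by field; rewrite gt_eqF.
lra.
Qed.

End Response.

(** * The proximal step and the step size *)

Section ProximalStep.
Local Open Scope classical_set_scope.
Local Open Scope ring_scope.
Variables (R : realType) (n : nat) (n_gt0 : (0 < n)%N) (C : R).
Hypothesis C_gt0 : 0 < C.
Implicit Types (p u x y : 'rV[R]_n) (a c m : R).

Lemma min_coord_le p k : min_coord n_gt0 p <= p 0 k.
Proof. exact: bigmin_le. Qed.

Lemma le_min_coord p m : (forall k, m <= p 0 k) -> m <= min_coord n_gt0 p.
Proof. by move=> mp; apply: le_bigmin. Qed.

(** Complementary slackness common to both branches of [y_center]: either [c = 0], or the positive
    parts sum to exactly [C * a]. In the second branch the intermediate value theorem supplies
    [c]. *)
Lemma y_center_spec a (yt : 'rV[R]_n) (c := y_center C a yt)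
    (s := \sum_(k < n) pos_part (c - yt 0 k)) : 0 < a ->
  [/\ 0 <= c, C * a <= s & c * (s - C * a) = 0].
Proof.
move=> a0; rewrite /s {s}; pose S t := \sum_(k < n) pos_part (t - yt 0 k).
have S0 : \sum_(k < n) pos_part (- yt 0 k) = S 0.
  by apply: eq_bigr => k _; rewrite sub0r.
rewrite {}/c /y_center -/(S _) S0.
case: ifPn => [CS|]; first by rewrite mul0r lexx.
rewrite -ltNge => SC; set c := xget _ _.
suff [c0 Sc] : 0 < c /\ S c = C * a by rewrite ltW// Sc subrr mulr0.
suff ex : exists t, 0 < t /\ S t = C * a by exact: (xgetPex 0 ex).
have Sge t k : t - yt 0 k <= S t.
  rewrite /S (bigD1 k)//= ler_wpDr//; last by rewrite le_max lexx.
  by apply: sumr_ge0 => j _; rewrite le_max lexx orbT.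
pose k0 := Ordinal n_gt0.
(* At this [B] the single coordinate [k0] already contributes at least [C * a]. *)
pose B := C * a + `|yt 0 k0|.
have B0 : 0 <= B by rewrite addr_ge0// mulr_ge0// ltW.
have SB : C * a <= S B.
  apply: le_trans (Sge B k0); rewrite /B.
  by have := ler_norm (yt 0 k0); lra.
have SC' : {within `[0, B], continuous S}.
  apply: continuous_subspaceT; apply: continuous_big => [|k _ t].
    exact: add_continuous.
  apply: (@continuous_max _ _ (fun t => t - yt 0 k) (cst 0)).
    by apply: cvgB; [exact: cvg_id|exact: cvg_cst].
  exact: cvg_cst.
have [|t] := @IVT _ S 0 B (C * a) B0 SC'.
  by rewrite ge_min le_max (ltW SC) SB orbT.
rewrite in_itv/= => /andP[t0 _] St; exists t; split=> //.
rewrite lt_neqAle t0 andbT; apply/eqP => t0'.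
by move: SC; rewrite t0' St ltxx.
Qed.

(* [y'] minimizes [a <x, u> - a C min u + |u - y|^2 / 2] over [u >= 0]; the
   objective being 1-strongly convex, the optimality gap at [u] is at least
   [|u - y'|^2 / 2]. *)
Lemma prox_step_ineq a x y u (yt := y - a *: x)
    (y' := \row_k Num.max (y_center C a yt) (yt 0 k)) :
  0 < a -> (forall k, 0 <= u 0 k) ->
  \sum_(k < n) (a * x 0 k * y' 0 k + (y' 0 k - y 0 k) ^+ 2 / 2)
    - C * a * min_coord n_gt0 y' <=
  \sum_(k < n) (a * x 0 k * u 0 k + (u 0 k - y 0 k) ^+ 2 / 2
                - (u 0 k - y' 0 k) ^+ 2 / 2) - C * a * min_coord n_gt0 u.
Proof.
move=> a0 u0; have [c0 Cs cs] := y_center_spec yt a0.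
set c := y_center C a yt in y' c0 Cs cs *.
set s := \sum_(k < n) _ in Cs cs.
have cy' : c <= min_coord n_gt0 y'.
  by apply: le_min_coord => k; rewrite mxE le_max lexx.
set m := min_coord n_gt0 u; set my := min_coord n_gt0 y' in cy' *.
have m0 : 0 <= m by apply: le_min_coord.
(* The [k]-th summand on the right equals [(u_k - y'_k)] times [pos_part (c - yt_k)], a weight that
   vanishes unless [y'_k = c]; the bound then follows from [u_k >= m]. *)
have : (m - c) * s <= \sum_(k < n)
    (a * x 0 k * u 0 k + (u 0 k - y 0 k) ^+ 2 / 2 - (u 0 k - y' 0 k) ^+ 2 / 2
      - (a * x 0 k * y' 0 k + (y' 0 k - y 0 k) ^+ 2 / 2)).
  rewrite mulr_sumr; apply: ler_sum => k _.
  have mk : m <= u 0 k := min_coord_le u k.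
  have ytE : yt 0 k = y 0 k - a * x 0 k by rewrite !mxE.
  rewrite [y' 0 k]mxE /pos_part ytE; case: (leP (y 0 k - a * x 0 k) c) => hc.
    have -> : Num.max (c - (y 0 k - a * x 0 k)) 0 = c - (y 0 k - a * x 0 k).
      by rewrite max_l// subr_ge0.
    have : 0 <= (c - (y 0 k - a * x 0 k)) * (u 0 k - m).
      by rewrite mulr_ge0// subr_ge0.
    lra.
  have -> : Num.max (c - (y 0 k - a * x 0 k)) 0 = 0.
    by rewrite max_r// subr_le0 ltW.
  rewrite mulr0; lra.
rewrite sumrB => H.
(* With complementarity, [(m - c) s >= C a (m - c)], and [c <= my] weakens this to
   [C a (m - my)]. *)
have : 0 <= m * (s - C * a) by rewrite mulr_ge0// subr_ge0.
have : 0 <= C * a * (my - c) by rewrite !mulr_ge0 ?subr_ge0// ltW.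
by move: H cs; lra.
Qed.

Lemma next_alpha_spec (mu A : R) (L := L_psi n mu) (a := next_alpha n mu A) :
  0 < mu -> 0 <= A -> 0 < a /\ A + a = L * a ^+ 2.
Proof.
move=> mu0 A0; have L0 : 0 < L by rewrite divr_gt0// ltr0n.
pose r := (1 + Num.sqrt (1 + 4 * L * A)) / (2 * L).
have LA0 : 0 <= L * A by apply: mulr_ge0 => //; exact: ltW.
have d0 : 0 <= 1 + 4 * L * A by lra.
have L20 : 0 < 2 * L by lra.
have r0 : 0 < r.
  by apply: divr_gt0 => //; rewrite ltr_pwDl// sqrtr_ge0.
have rE : A + r = L * r ^+ 2.
  have sE := sqr_sqrtr d0; rewrite /r; set t := Num.sqrt _ in sE *.
  have -> : A = (t ^+ 2 - 1) / (4 * L) by rewrite sE; field; rewrite gt_eqF.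
  by field; rewrite gt_eqF.
(* Since [L r >= 1], the map [b -> L b^2 - b] increases strictly beyond [r], so no root exceeds
   [r]. *)
have Lr : 1 <= L * r.
  rewrite -(ler_pM2r r0) mul1r; move: rE; rewrite expr2 mulrA; lra.
have rmax b : A + b = L * b ^+ 2 -> b <= r.
  move=> bE; rewrite leNgt; apply/negP => rb.
  have : 0 < (b - r) * (L * (b + r) - 1).
    apply: mulr_gt0; first by rewrite subr_gt0.
    have : 0 < L * b by apply: mulr_gt0 => //; exact: lt_trans r0 rb.
    lra.
  move: bE rE; lra.
have [aE amax] : A + a = L * a ^+ 2 /\
    forall b, A + b = L * b ^+ 2 -> b <= a.
  have ex : exists a, A + a = L * a ^+ 2 /\
    forall b, A + b = L * b ^+ 2 -> b <= a by exists r.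
  exact: (xgetPex 0 ex).
by split=> //; apply: lt_le_trans r0 (amax _ rE).
Qed.

End ProximalStep.

(** * Jensen's inequality, weak duality and the a priori bound on dual solutions *)

Section Method.
Variables (R : realType) (n : nat) (n_gt0 : (0 < n)%N) (C mu : R).
Variable f : 'I_n -> R -> R.
Hypotheses (C_gt0 : 0 < C) (mu_gt0 : 0 < mu).
Hypothesis f_incr : forall k, increasing_on_nneg (f k).
Hypothesis f_sconvex : forall k, strongly_convex_on_nneg mu (f k).
Implicit Types (p u w x y : 'rV[R]_n) (s : acgm_state R n).

Local Notation nneg v := (forall k, 0 <= v 0 k).
Local Notation phi := (dual_objective C f n_gt0).
Local Notation sqdist u v := (\sum_(k < n) (u 0 k - v 0 k) ^+ 2 / 2).
Local Notation lagrangian x u :=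
  (\sum_(k < n) (x 0 k * u 0 k - f k (x 0 k)) - C * min_coord n_gt0 u).

Let n_gt0R : 0 < n%:R :> R. Proof. by rewrite ltr0n. Qed.

Lemma jensen_nneg k (a x : nat -> R) T (A := \sum_(t < T) a t)
    (X := \sum_(t < T) a t * x t) :
  (forall t, 0 <= a t) -> (forall t, 0 <= x t) ->
  A * f k (A^-1 * X) <= \sum_(t < T) a t * f k (x t).
Proof.
move=> a0 x0.
(* The second conjunct says that [X = 0] when [A = 0]. That case does occur, since the method starts
   with weight 0. *)
suff : A * f k (A^-1 * X) <= \sum_(t < T) a t * f k (x t) /\ X = A * (A^-1 * X).
  by case.
rewrite /A /X {A X}; elim: T => [|T [IH XE]].
  by rewrite !big_ord0 !mul0r.
rewrite !big_ord_recr/=.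
have A0 : 0 <= \sum_(t < T) a t by exact: sumr_ge0.
have X0 : 0 <= \sum_(t < T) a t * x t.
  by apply: sumr_ge0 => t _; exact: mulr_ge0.
set A := \sum_(t < T) a t in A0 IH XE *.
set X := \sum_(t < T) a t * x t in X0 IH XE *.
set G := \sum_(t < T) _ in IH *.
have aT0 := a0 T; have xT0 := x0 T.
set b := a T in aT0 *; set z := x T in xT0 *.
have [Ab|Ab] := eqVneq (A + b) 0.
  have [AE bE] : A = 0 /\ b = 0 by split; lra.
  have XE0 : X = 0 by rewrite XE AE mul0r.
  by move: IH; rewrite AE bE XE0 !(mul0r, addr0).
have Ab0 : 0 < A + b by rewrite lt_neqAle eq_sym Ab addr_ge0.
split; last by rewrite mulrA divff// mul1r.
have v0 : 0 <= A^-1 * X by rewrite mulr_ge0// invr_ge0.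
have c0 : 0 <= A / (A + b) by rewrite divr_ge0// ltW.
have d0 : 0 <= b / (A + b) by rewrite divr_ge0// ltW.
have cd : A / (A + b) + b / (A + b) = 1 by rewrite -mulrDl divff.
have := strongly_convex_ineq (f_sconvex k) v0 xT0 c0 d0 cd.
rewrite -/z; set v := A^-1 * X in v0 IH XE *.
have -> : A / (A + b) * v + b / (A + b) * z = (A + b)^-1 * (X + b * z).
  by rewrite XE; field.
rewrite -(ler_pM2l Ab0) => H.
have gap : 0 <= mu / 2 * (A / (A + b)) * (b / (A + b)) * (v - z) ^+ 2.
  rewrite mulr_ge0 ?sqr_ge0// mulr_ge0// mulr_ge0//.
  by rewrite divr_ge0// ltW.
apply: le_trans H _; set g := _ * _ ^+ 2 in gap *.
have -> : (A + b) * (A / (A + b) * f k v + b / (A + b) * f k z - g) =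
    A * f k v + b * f k z - (A + b) * g by field.
have : 0 <= (A + b) * g by rewrite mulr_ge0// ltW.
by move: IH; lra.
Qed.

Lemma responses_ge0 p : nneg p -> nneg (responses f p).
Proof. by move=> p0 k; rewrite mxE (response_ge0 mu_gt0). Qed.

(** The Fenchel-Young inequality in each coordinate, with [w_k] lowered to the minimal
    coordinate. *)
Lemma weak_duality w x : nneg w -> nneg x ->
  min_coord n_gt0 w * (\sum_(k < n) x 0 k - C) <= phi w + objective f x.
Proof.
move=> w0 x0.
have : \sum_(k < n) (min_coord n_gt0 w * x 0 k) <=
    \sum_(k < n) (conjugate f k (w 0 k) + f k (x 0 k)).
  apply: ler_sum => k _.
  have := conjugate_ge mu_gt0 f_incr f_sconvex k (w0 k) (x0 k).
  have : 0 <= (w 0 k - min_coord n_gt0 w) * x 0 k.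
    by rewrite mulr_ge0// subr_ge0 min_coord_le.
  lra.
rewrite -mulr_sumr big_split/= /objective /dual_objective /conjugate; lra.
Qed.

(** Weak duality at the constant point [2 C / n], whose coordinate sum exceeds [C] by exactly [C],
    combined with optimality against [p = 0]. *)
Lemma min_coord_dual_optimal w : dual_optimal C f n_gt0 w ->
  C * min_coord n_gt0 w <= \sum_(k < n) f k (2 * C / n%:R) - \sum_(k < n) f k 0.
Proof.
move=> [w0 wopt].
have x0 : nneg (const_mx (2 * C / n%:R) : 'rV[R]_n).
  by move=> k; rewrite mxE divr_ge0// mulr_ge0// ltW.
have := weak_duality w0 x0.
have z0 : nneg (0 : 'rV[R]_n) by move=> k; rewrite mxE.
have := wopt 0 z0.
have : phi 0 <= - \sum_(k < n) f k 0.
  rewrite /dual_objective -sumrN.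
  have : \sum_(k < n) ((0 : 'rV[R]_n) 0 k * response f k ((0 : 'rV[R]_n) 0 k)
      - f k (response f k ((0 : 'rV[R]_n) 0 k))) <= \sum_(k < n) - f k 0.
    apply: ler_sum => k _; rewrite mxE mul0r sub0r lerN2 f_incr//.
    by rewrite (response_ge0 mu_gt0).
  have : 0 <= C * min_coord n_gt0 (0 : 'rV[R]_n).
    by apply: mulr_ge0; [exact: ltW|exact: le_min_coord].
  lra.
have -> : objective f (const_mx (2 * C / n%:R)) =
    \sum_(k < n) f k (2 * C / n%:R) by apply: eq_bigr => k _; rewrite mxE.
have -> : \sum_(k < n) (const_mx (2 * C / n%:R) : 'rV[R]_n) 0 k = 2 * C.
  under eq_bigr do rewrite mxE.
  by rewrite sumr_const card_ord -[LHS]mulr_natr divfK// gt_eqF.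
lra.
Qed.

Lemma p_max_gt0 : 0 < p_max C f.
Proof.
rewrite /p_max mulr_gt0 ?divr_gt0// -sumrB.
have z0 : 0 < 2 * C / n%:R by rewrite divr_gt0// mulr_gt0.
rewrite (bigD1 (Ordinal n_gt0))//= ltr_pwDl//.
  have := quadratic_growth f_incr f_sconvex (Ordinal n_gt0) (ltW z0).
  have : 0 < mu / 4 * (2 * C / n%:R) ^+ 2.
    by rewrite mulr_gt0 ?exprn_gt0// divr_gt0.
  lra.
by apply: sumr_ge0 => k _; rewrite subr_ge0 f_incr// ltW.
Qed.

(** * Potential estimate for a single step *)

Section Step.
Variable s : acgm_state R n.
Hypotheses (A_ge0 : 0 <= acgm_A s) (y_ge0 : nneg (acgm_y s)).
Hypothesis w_ge0 : nneg (acgm_w s).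
Let s' := acgm_step C mu f s.

Lemma acgm_step_alpha : 0 < acgm_alpha s' /\
  acgm_A s + acgm_alpha s' = L_psi n mu * acgm_alpha s' ^+ 2.
Proof. exact: next_alpha_spec. Qed.

Lemma acgm_step_nneg :
  [/\ 0 < acgm_A s', nneg (acgm_p s'), nneg (acgm_y s') & nneg (acgm_w s')].
Proof.
have [a0 _] := acgm_step_alpha.
have A'0 : 0 < acgm_A s' by rewrite ltr_wpDl.
have avg (v : 'rV[R]_n) : nneg v -> nneg ((acgm_A s')^-1 *:
    (acgm_alpha s' *: v + acgm_A s *: acgm_w s)).
  move=> v0 k; rewrite !mxE; apply: mulr_ge0; first by rewrite invr_ge0 ltW.
  by apply: addr_ge0; apply: mulr_ge0 => //; exact: ltW.
have y'0 : nneg (acgm_y s').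
  move=> k; rewrite mxE le_max; apply/orP; left.
  by have [] := y_center_spec n_gt0 C_gt0
    (acgm_y s - acgm_alpha s' *: responses f (acgm_p s')) a0.
by split=> //; exact: avg.
Qed.

Lemma acgm_step_descent u : nneg u ->
  acgm_A s' * phi (acgm_w s') + sqdist u (acgm_y s') <=
  acgm_A s * phi (acgm_w s) + sqdist u (acgm_y s)
  + acgm_alpha s' * lagrangian (responses f (acgm_p s')) u.
Proof.
move=> u0; have [a0 LaE] := acgm_step_alpha.
have [A'0 p0 y'0 w'0] := acgm_step_nneg.
have := prox_step_ineq n_gt0 C_gt0 (responses f (acgm_p s')) (acgm_y s) a0 u0.
rewrite -[\row__ _]/(acgm_y s').
set x := responses f (acgm_p s'); have x0 : nneg x by exact: responses_ge0.
have A'E : acgm_A s' = acgm_A s + acgm_alpha s' by [].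
have wE k : acgm_w s' 0 k = (acgm_alpha s' * acgm_y s' 0 k
    + acgm_A s * acgm_w s 0 k) / acgm_A s'.
  by rewrite [acgm_w s']/(_ *: _) !mxE mulrC.
have pE k : acgm_p s' 0 k = (acgm_alpha s' * acgm_y s 0 k
    + acgm_A s * acgm_w s 0 k) / acgm_A s'.
  by rewrite [acgm_p s']/(_ *: _) !mxE mulrC.
have xE k : x 0 k = response f k (acgm_p s' 0 k) by rewrite mxE.
clearbody x.
move: A'E wE pE a0 LaE A'0 p0 y'0 w'0 xE.
move: (acgm_A s') (acgm_alpha s') (acgm_p s') (acgm_y s') (acgm_w s').
move: (acgm_A s) A_ge0 (acgm_y s) (acgm_w s) w_ge0.
move=> A A0 y w w0 A' a p y' w' A'E wE pE a0 LaE A'0 p0 y'0 w'0 xE prox.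
(* Concavity of the minimum, applied to [w'] as a weighted mean of [y'] and [w]. *)
have minw : a * min_coord n_gt0 y' + A * min_coord n_gt0 w
    <= A' * min_coord n_gt0 w'.
  rewrite [leRHS]mulrC -ler_pdivrMr//; apply: le_min_coord => k.
  rewrite wE ler_pM2r ?invr_gt0//.
  by apply: lerD; apply: ler_wpM2l; rewrite ?min_coord_le// ltW.
have coord : A' * (\sum_(k < n) conjugate f k (w' 0 k)) <= \sum_(k < n)
   (A * conjugate f k (w 0 k) - a * f k (x 0 k)
     + (a * x 0 k * y' 0 k + (y' 0 k - y 0 k) ^+ 2 / 2)).
  rewrite mulr_sumr; apply: ler_sum => k _.
  have smooth := conjugate_smooth mu_gt0 f_incr f_sconvex k (p0 k) (w'0 k).
  have lower := conjugate_ge mu_gt0 f_incr f_sconvex k (w0 k) (x0 k).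
  have dE : w' 0 k - p 0 k = a * (y' 0 k - y 0 k) / A'.
    by rewrite wE pE; field; rewrite gt_eqF.
  (* As [A' = (n / mu) a^2], the smoothness error is [1 / n] times the proximal term, which
     therefore absorbs it. *)
  have quad : A' * ((w' 0 k - p 0 k) ^+ 2 / (2 * mu))
      <= (y' 0 k - y 0 k) ^+ 2 / 2.
    rewrite dE; set e := y' 0 k - y 0 k.
    have -> : A' * ((a * e / A') ^+ 2 / (2 * mu)) =
        a ^+ 2 / (mu * A') * (e ^+ 2 / 2) by field; rewrite !gt_eqF.
    rewrite ler_piMl ?divr_ge0 ?sqr_ge0// ler_pdivrMr ?mulr_gt0// mul1r.
    rewrite A'E LaE /L_psi mulrA [mu * _]mulrC divfK ?gt_eqF//.
    by rewrite ler_peMl ?sqr_ge0// ler1n.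
  (* The linearization at [p] is the affine map [v -> x v - f x], so at [w'] it splits into its
     values at [y'] and [w]. *)
  have linear : A' * (conjugate f k (p 0 k)
        + response f k (p 0 k) * (w' 0 k - p 0 k)) =
      a * x 0 k * y' 0 k + A * (w 0 k * x 0 k) - (A + a) * f k (x 0 k).
    by rewrite /conjugate -xE wE A'E; field; rewrite -A'E gt_eqF.
  have := ler_wpM2l (ltW A'0) smooth; rewrite [leRHS]mulrDr linear.
  by have := ler_wpM2l A0 lower; move: quad; lra.
have h3 := ler_wpM2l (ltW C_gt0) minw.
have axu : \sum_(k < n) a * x 0 k * u 0 k = a * \sum_(k < n) x 0 k * u 0 k.
  by rewrite mulr_sumr; apply: eq_bigr => k _; rewrite mulrA.
move: prox; rewrite [in leRHS]sumrB [in leRHS]big_split/= axu.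
have conjE : \sum_(k < n) (A * conjugate f k (w 0 k) - a * f k (x 0 k)) =
    A * \sum_(k < n) conjugate f k (w 0 k) - a * \sum_(k < n) f k (x 0 k).
  by rewrite sumrB -!mulr_sumr.
move: coord; rewrite [leRHS]big_split/= conjE.
rewrite [\sum_(k < n) (x 0 k * u 0 k - _)]sumrB /dual_objective.
by rewrite -!/(conjugate f _ _); move: h3; lra.
Qed.

End Step.

(** * Accumulated estimates along the iterates *)

Section Trajectory.
Variable p0 : 'rV[R]_n.
Hypothesis p0_ge0 : nneg p0.

Local Notation st t := (acgm C mu f p0 t).
Local Notation xp t := (responses f (acgm_p (st t))).
Local Notation alpha t := (acgm_alpha (st t)).
Local Notation A t := (acgm_A (st t)).

Lemma acgm_nneg t : [/\ 0 <= A t, 0 <= alpha t, nneg (acgm_p (st t)),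
  nneg (acgm_y (st t)) & nneg (acgm_w (st t))].
Proof.
elim: t => [//|t [A0 _ _ y0 w0]].
have [/ltW A'0 p'0 y'0 w'0] := acgm_step_nneg A0 y0 w0.
by have [/ltW a0 _] := acgm_step_alpha A0.
Qed.

Lemma acgm_A_sum t : A t = \sum_(i < t.+1) alpha i.
Proof.
by elim: t => [|t IH]; [rewrite big_ord1|rewrite big_ord_recr/= -IH].
Qed.

(** The one-step bounds telescope; [A 0 = 0] removes the dual value at the starting point. *)
Lemma acgm_estimate t u : nneg u ->
  A t * phi (acgm_w (st t)) + sqdist u (acgm_y (st t)) <=
  \sum_(i < t.+1) alpha i * lagrangian (xp i) u + sqdist u p0.
Proof.
move=> u0; elim: t => [|t IH]; first by rewrite big_ord1 !mul0r.
have [A0 _ _ y0 w0] := acgm_nneg t.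
have := acgm_step_descent A0 y0 w0 u0.
by rewrite -[acgm_step _ _ _ _]/(st t.+1) big_ord_recr/=; move: IH; lra.
Qed.

(* [s = 2 L alpha] satisfies [s^2 - 2 s = 4 L A], so it grows by at least one
   at each step. *)
Lemma acgm_alpha_growth t : t%:R + 2 <= 2 * L_psi n mu * alpha t.+1.
Proof.
have L0 : 0 < L_psi n mu by rewrite /L_psi divr_gt0.
have root i : [/\ 0 < alpha i.+1,
    A i.+1 = L_psi n mu * alpha i.+1 ^+ 2 &
    2 <= 2 * L_psi n mu * alpha i.+1].
  have [A0 _ _ _ _] := acgm_nneg i.
  have [a0 aE] := acgm_step_alpha A0.
  split=> //; rewrite -mulrA ler_peMr//.
  rewrite -(ler_pM2r a0) mul1r -mulrA -expr2 -aE.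
  by rewrite lerDr.
elim: t => [|t IH]; first by rewrite add0r; have [] := root 0.
have [_ AE _] := root t; have [_ AE' s2] := root t.+1.
move: AE'; rewrite -[A t.+2]/(A t.+1 + alpha t.+2) AE => aE.
have {aE} : (2 * L_psi n mu * alpha t.+1) ^+ 2
    = (2 * L_psi n mu * alpha t.+2) * (2 * L_psi n mu * alpha t.+2 - 2).
  apply/eqP; rewrite -subr_eq0 -[X in _ - X]opprK opprK; apply/eqP.
  transitivity (4 * L_psi n mu * (L_psi n mu * alpha t.+1 ^+ 2
     + alpha t.+2 - L_psi n mu * alpha t.+2 ^+ 2)); first by ring.
  by rewrite aE subrr mulr0.
move: IH s2; rewrite -natr1.
move: (2 * _ * alpha t.+1) (2 * _ * alpha t.+2) => r s IH s2 rE.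
have T0 : 0 <= t%:R :> R by [].
have : (t%:R + 2) ^+ 2 <= r ^+ 2.
  by rewrite ler_sqr ?nnegrE//; lra.
rewrite rE leNgt => h; rewrite leNgt; apply: contra h => sT.
(* The product equals [(t + 1) (t + 3) - (s^2 - 2 s)], and [(t + 1) (t + 3) = (t + 2)^2 - 1]. *)
have : 0 < (t%:R + 1 + 2 - s) * (s + t%:R + 1).
  by apply: mulr_gt0; lra.
lra.
Qed.

Lemma acgm_A_lower t : (t.+1%:R + 1) ^+ 2 * mu <= 4 * n%:R * A t.+1.
Proof.
have [A0 _ _ _ _] := acgm_nneg t.
have [_ AE] := acgm_step_alpha A0.
have aT := acgm_alpha_growth t.
rewrite -[A t.+1]/(A t + alpha t.+1) AE.
have -> : 4 * n%:R * (L_psi n mu * alpha t.+1 ^+ 2) =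
    (2 * L_psi n mu * alpha t.+1) ^+ 2 * mu.
  by rewrite /L_psi; field; rewrite gt_eqF.
rewrite ler_pM2r//.
have T0 : 0 <= t%:R :> R by [].
by rewrite ler_sqr ?nnegrE -natr1; lra.
Qed.

Lemma x_hatE N k :
  x_hat C mu f p0 N 0 k = (A N)^-1 * \sum_(i < N.+1) alpha i * xp i 0 k.
Proof.
rewrite mxE summxE big_mkord; congr (_ * _).
by apply: eq_bigr => i _; rewrite mxE.
Qed.

Lemma xp_ge0 i : nneg (xp i).
Proof. by have [_ _ ? _ _] := acgm_nneg i; exact: responses_ge0. Qed.

Lemma x_hat_ge0 N : nneg (x_hat C mu f p0 N).
Proof.
move=> k; have [A0 _ _ _ _] := acgm_nneg N.
rewrite x_hatE mulr_ge0 ?invr_ge0// sumr_ge0// => i _.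
by have [_ a0 _ _ _] := acgm_nneg i; rewrite mulr_ge0// xp_ge0.
Qed.

(** With [u] constant equal to [c], the term [<x, u> - C min u] becomes [c] times the constraint
    excess [sum x - C], so [c] acts as a multiplier; Jensen's inequality moves [f] to the averaged
    point. *)
Lemma gap_le N (c : R) : (0 < N)%N -> 0 <= c ->
  phi (acgm_w (st N)) + objective f (x_hat C mu f p0 N)
    + c * (C - \sum_(k < n) x_hat C mu f p0 N 0 k)
  <= (\sum_(k < n) (c - p0 0 k) ^+ 2 / 2) / A N.
Proof.
case: N => // N _ c0.
have AN0 : 0 < A N.+1.
  by have [A0 _ _ y0 w0] := acgm_nneg N; have [] := acgm_step_nneg A0 y0 w0.
set B := A N.+1 in AN0 *.
set X := x_hat _ _ _ _ _.
pose u : 'rV[R]_n := const_mx c.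
have u0 : nneg u by move=> k; rewrite mxE.
have cu : c <= min_coord n_gt0 u by apply: le_min_coord => k; rewrite mxE.
have est := acgm_estimate N.+1 u0; rewrite -/B in est.
have d0 : 0 <= sqdist u (acgm_y (st N.+1)).
  by apply: sumr_ge0 => k _; rewrite divr_ge0 ?sqr_ge0.
have p0E : sqdist u p0 = \sum_(k < n) (c - p0 0 k) ^+ 2 / 2.
  by apply: eq_bigr => k _; rewrite mxE.
have sumX : \sum_(i < N.+2) alpha i * \sum_(k < n) xp i 0 k
    = B * \sum_(k < n) X 0 k.
  under eq_bigr do rewrite mulr_sumr.
  rewrite exchange_big mulr_sumr; apply: eq_bigr => k _.
  by rewrite x_hatE -/B mulrA divff ?mul1r// gt_eqF.
have jensen : B * objective f X <=
    \sum_(i < N.+2) alpha i * \sum_(k < n) f k (xp i 0 k).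
  under eq_bigr do rewrite mulr_sumr.
  rewrite exchange_big mulr_sumr; apply: ler_sum => k _.
  rewrite x_hatE -/B /B acgm_A_sum.
  apply: (@jensen_nneg k (fun i => alpha i) (fun i => xp i 0 k)) => i.
    by have [] := acgm_nneg i.
  exact: xp_ge0.
have lag : \sum_(i < N.+2) alpha i * lagrangian (xp i) u <=
   c * (B * \sum_(k < n) X 0 k)
   - \sum_(i < N.+2) alpha i * \sum_(k < n) f k (xp i 0 k) - B * (C * c).
  rewrite -sumX {1}/B acgm_A_sum mulr_suml mulr_sumr -!sumrB.
  apply: ler_sum => i _; rewrite sumrB.
  have -> : \sum_(k < n) xp i 0 k * u 0 k = c * \sum_(k < n) xp i 0 k.
    by rewrite mulr_sumr; apply: eq_bigr => k _; rewrite [u 0 k]mxE mulrC.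
  have [_ a0 _ _ _] := acgm_nneg i.
  have : 0 <= alpha i * (C * (min_coord n_gt0 u - c)).
    by rewrite mulr_ge0// mulr_ge0 ?subr_ge0// ltW.
  lra.
rewrite ler_pdivlMr// -p0E; move: est d0 jensen lag; lra.
Qed.

End Trajectory.

End Method.

(** * Convergence rates for the gap and the infeasibility *)

Theorem theorem3 (R : realType) (n : nat) (n_gt0 : (0 < n)%N) (C mu : R)
  (C_gt0 : 0 < C) (mu_gt0 : 0 < mu) (f : 'I_n -> R -> R)
  (f_incr : forall k, increasing_on_nneg (f k))
  (f_sconvex : forall k, strongly_convex_on_nneg mu (f k))
  (xstar wstar : 'rV[R]_n)
  (xstar_opt : exists ystar, primal_optimal C f xstar ystar)
  (wstar_opt : dual_optimal C f n_gt0 wstar)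
  (N : nat) (N_ge1 : (1 <= N)%N) (p0 : 'rV[R]_n)
  (p0_bound : forall k, 0 <= p0 0 k <= p_max C f) :
  let xhat := x_hat C mu f p0 N in
  let wN := acgm_w (acgm C mu f p0 N) in
  [/\ objective f xhat - objective f xstar
        <= objective f xhat + dual_objective C f n_gt0 wstar,
      objective f xhat + dual_objective C f n_gt0 wstar
        <= dual_objective C f n_gt0 wN + objective f xhat,
      dual_objective C f n_gt0 wN + objective f xhat
        <= 148 * n%:R ^+ 2 * p_max C f ^+ 2 / ((N%:R + 1) ^+ 2 * mu)
    & pos_part (C - \sum_(k < n) xhat 0 k)
        <= 148 * n%:R ^+ 2 * p_max C f / (5 * (N%:R + 1) ^+ 2 * mu)].
Proof.
move=> xhat wN.
have p0_ge0 k : 0 <= p0 0 k by have /andP[] := p0_bound k.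
set P := p_max C f in p0_bound *.
have P0 : 0 < P := p_max_gt0 n_gt0 C_gt0 mu_gt0 f_incr f_sconvex.
have n0 : 0 < n%:R :> R by rewrite ltr0n.
have [wstar_ge0 wstar_min] := wstar_opt.
have [_ _ _ _ wN_ge0] := acgm_nneg n_gt0 f C_gt0 mu_gt0 p0_ge0 N.
have xhat_ge0 := x_hat_ge0 n_gt0 C_gt0 mu_gt0 f_incr f_sconvex p0_ge0 N.
have weak x := weak_duality n_gt0 C mu_gt0 f_incr f_sconvex (x := x) wstar_ge0.
set m := min_coord n_gt0 wstar in weak.
have m0 : 0 <= m by apply: le_min_coord.
have strong : 0 <= objective f xstar + dual_objective C f n_gt0 wstar.
  have [ystar [[yC xy] _]] := xstar_opt.
  have x0 k : 0 <= xstar 0 k by have [] := xy k.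
  rewrite addrC; apply: le_trans (weak _ x0); rewrite mulr_ge0// subr_ge0.
  by apply: le_trans yC _; apply: ler_sum => k _; have [] := xy k.
have dual_le : dual_objective C f n_gt0 wstar <= dual_objective C f n_gt0 wN.
  exact: wstar_min.
set B := acgm_A (acgm C mu f p0 N).
set T := (N%:R + 1 : R).
have T0 : 0 < T by rewrite ltr_wpDl.
have BT : T ^+ 2 * mu <= 4 * n%:R * B.
  rewrite /T /B; case: (N) N_ge1 => // N' _.
  exact (acgm_A_lower n_gt0 f C_gt0 mu_gt0 p0_ge0 N').
have Tmu : 0 < T ^+ 2 * mu by rewrite mulr_gt0 ?exprn_gt0.
have B0 : 0 < B by rewrite -(pmulr_rgt0 _ (mulr_gt0 (ltr0n R 4) n0)); lra.
have gap c := gap_le n_gt0 C_gt0 mu_gt0 f_incr f_sconvex p0_ge0 (c := c) N_ge1.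
(* The half squared distance is at most [n r / 2], and [B >= T^2 mu / (4 n)]; this is the source of
   the factor [2 n^2]. *)
have distE (c r : R) : (forall k, (c - p0 0 k) ^+ 2 <= r) ->
    (\sum_(k < n) (c - p0 0 k) ^+ 2 / 2) / B <=
      2 * n%:R ^+ 2 * r / (T ^+ 2 * mu).
  move=> cr; have r0 : 0 <= r.
    by apply: le_trans (cr (Ordinal n_gt0)); exact: sqr_ge0.
  have : \sum_(k < n) (c - p0 0 k) ^+ 2 / 2 <= n%:R * (r / 2).
    rewrite mulr_natl -[n in leRHS]card_ord -sumr_const.
    by apply: ler_sum => k _; rewrite ler_pM2r.
  rewrite ler_pdivrMr// => /le_trans; apply.
  rewrite mulrAC ler_pdivlMr//.
  have : 0 <= n%:R * r / 2 * (4 * n%:R * B - T ^+ 2 * mu).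
    by rewrite mulr_ge0 ?subr_ge0// !mulr_ge0// ltW.
  lra.
have gap0 : dual_objective C f n_gt0 wN + objective f xhat <=
    2 * n%:R ^+ 2 * P ^+ 2 / (T ^+ 2 * mu).
  have := gap 0 (lexx _); rewrite mul0r addr0 => /le_trans; apply.
  apply: distE => k; rewrite sub0r sqrrN; have /andP[? ?] := p0_bound k.
  by rewrite ler_sqr ?nnegrE// ltW.
have gapP : dual_objective C f n_gt0 wN + objective f xhat
      + 2 * P * (C - \sum_(k < n) xhat 0 k) <=
    2 * n%:R ^+ 2 * (4 * P ^+ 2) / (T ^+ 2 * mu).
  have P2 : 0 <= 2 * P by lra.
  apply: le_trans (gap _ P2) _.
  apply: distE => k; have /andP[? ?] := p0_bound k.
  have -> : 4 * P ^+ 2 = (2 * P) ^+ 2 by ring.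
  by rewrite ler_sqr ?nnegrE//; lra.
have mP : m <= P.
  have := min_coord_dual_optimal C_gt0 mu_gt0 f_incr f_sconvex wstar_opt.
  rewrite -/m -ler_pdivlMl// => /le_trans; apply.
  have : 0 < C^-1 * (\sum_(k < n) f k (2 * C / n%:R) - \sum_(k < n) f k 0).
    by rewrite -(pmulr_rgt0 _ n0) mulrA.
  move=> h; rewrite /P /p_max -[leRHS]mulrA ler_peMl ?ler1n//; exact: ltW.
set K := n%:R ^+ 2 / (T ^+ 2 * mu).
have K0 : 0 < K by rewrite divr_gt0// exprn_gt0.
have gap0' : 2 * n%:R ^+ 2 * P ^+ 2 / (T ^+ 2 * mu) = 2 * P ^+ 2 * K.
  by rewrite /K; ring.
split.
- by lra.
- by lra.
- apply: le_trans gap0 _; rewrite gap0'.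
  have -> : 148 * n%:R ^+ 2 * P ^+ 2 / (T ^+ 2 * mu) = 148 * P ^+ 2 * K.
    by rewrite /K; ring.
  by rewrite ler_pM2r// ler_pM2r ?exprn_gt0// ler_nat.
- have -> : 148 * n%:R ^+ 2 * P / (5 * T ^+ 2 * mu) = 148 / 5 * P * K.
    by rewrite /K; field; rewrite !gt_eqF.
  have PK : 0 < P * K by exact: mulr_gt0.
  rewrite /pos_part ge_max; apply/andP; split; last by lra.
  set D := C - \sum_(k < n) xhat 0 k in gapP *.
  have lower := weak _ xhat_ge0.
  have [D0|D0] := leP D 0; first by lra.
  (* Weak duality bounds the gap below by [- m D], so [gapP] gives [(2 P - m) D <= 8 P^2 K], where
     [2 P - m >= P]. The resulting constant 8 is below [148 / 5]. *)
  have : P * D <= P * (8 * P * K).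
    have : 2 * n%:R ^+ 2 * (4 * P ^+ 2) / (T ^+ 2 * mu) = 8 * P * (P * K).
      by rewrite /K; ring.
    have : 0 <= (P - m) * D.
      by apply: mulr_ge0; [rewrite subr_ge0|exact: ltW].
    move: lower; rewrite -[_ - C]opprB -/D -/xhat; lra.
  rewrite ler_pM2l//; lra.
Qed.
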